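(* Suppose that all Hopf bifurcations of (1) are subcritical, i.e. $C>H(m)B^2$ for every $m\in\mathbb Z$, and let $k\ge0$ be an integer. Then for all sufficiently small $\eta>0$, the minimal period of the periodic solution on the $k$th Hopf branch at parameter $\mu_k-\eta$ satisfies $$T^k_\eta\ \le\ \frac{4}{4k+1-\frac{2\eta}{\pi}}.$$
   Context: Consider the scalar delay differential equation (1) $x'(t)=-\mu f(x(t-1))$, with real parameter $\mu$ and phase space $C([-1,0],\mathbb R)$. Here $f:\mathbb R\to\mathbb R$ is $C^3$ with $f(0)=0$ and $f'(0)=1$, so that $f(\xi)=\xi+B\xi^2+C\xi^3+o(\xi^3)$ with $B=f''(0)/2$ and $C=f'''(0)/6$. For $k\in\mathbb Z$ let $\mu_k=\frac{(4k+1)\pi}{2}$ and $H(k)=\frac{22(4k+1)\pi-8}{15(4k+1)\pi}$. The $k$th Hopf bifurcation (at $\mu_k$) is supercritical if $C<H(k)B^2$ and subcritical if $C>H(k)B^2$; it is called nondegenerate if $C\ne H(k)B^2$. Supercritical means the bifurcating small periodic orbits are stable within the center manifold; subcritical means they are unstable there. Hopf branch notation, for $k\ge0$ with a nondegenerate $k$th bifurcation: put $\delta_k=1$ if it is supercritical and $\delta_k=-1$ if it is subcritical. There are $\eta_k>0$ and a family of nonconstant periodic solutions $p^k_\eta$, $\eta\in(0,\eta_k)$, of (1) with parameter $\mu=\mu_k+\delta_k\eta$. These bifurcate from $0$ at $\mu_k$ (amplitude $\to0$ as $\eta\to0$), and they are locally unique up to time translation. $T^k_\eta$ denotes the minimal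 period of $p^k_\eta$, and $T^k_\eta\to T^k_0:=\frac{4}{4k+1}$ as $\eta\to0$. *)

(* Defs.v *)
From Stdlib Require Import Reals.
Open Scope R_scope.

Definition C3_with (f f1 f2 f3 : R -> R) : Prop :=
  (forall x, derivable_pt_lim f x (f1 x)) /\
  (forall x, derivable_pt_lim f1 x (f2 x)) /\
  (forall x, derivable_pt_lim f2 x (f3 x)) /\
  continuity f3.

Definition mu (k : R) : R := (4 * k + 1) * PI / 2.

Definition Hk (k : R) : R :=
  (22 * (4 * k + 1) * PI - 8) / (15 * (4 * k + 1) * PI).

Definition is_solution (mu : R) (f : R -> R) (x : R -> R) : Prop :=
  forall t, derivable_pt_lim x t (- mu * f (x (t - 1))).

Definition is_period (x : R -> R) (T : R) : Prop :=
  forall t, x (t + T) = x t.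

Definition is_min_period (x : R -> R) (T : R) : Prop :=
  0 < T /\ is_period x T /\ (forall S, 0 < S < T -> ~ is_period x S).

Definition nonconstant (x : R -> R) : Prop := exists t s, x t <> x s.

Definition subcritical_hopf_branch (f : R -> R) (k : nat) (etak : R)
    (p : R -> R -> R) (T : R -> R) : Prop :=
  0 < etak /\
  (forall eta, 0 < eta < etak ->
     is_solution (mu (INR k) - eta) f (p eta) /\ nonconstant (p eta) /\
     is_min_period (p eta) (T eta)) /\
  (forall eps, 0 < eps -> exists d, 0 < d /\
     forall eta, 0 < eta < etak -> eta < d -> forall t, Rabs (p eta t) < eps) /\
  (forall eps, 0 < eps -> exists d, 0 < d /\
     forall eta, 0 < eta < etak -> eta < d ->
       Rabs (T eta - 4 / (4 * INR k + 1)) < eps).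

(* Main.v *)
(* Rescaling time by the frequency [2 pi / T] turns the orbit into a [2 pi]-periodic solution of
   [y'(s) = - lam f(y(s - tau))] with [lam = mu T / (2 pi)] near [1] and
   [tau = 2 pi / T - 2 pi k] near [pi / 2]; the claim becomes [lam <= 1].  Comparing the moduli of
   the first Fourier coefficients of both sides, it says that the first harmonic of [f o y] is at
   least as large as that of [y].  After a translation, [y = b sin + r] with [r = O(b^2)] free of
   first harmonics, and the zeroth and second harmonics of the equation give the parts of [r] that
   interact with [sin^2]; then
   [b * int (f(y) - y) sin = 3/4 pi (C - 22/15 B^2) b^4 + o(b^4)].
   This is positive since subcriticality at [m = -1], where [H(-1) > 22/15], gives
   [C > 22/15 B^2].  The bound on [r] comes from [r''(s) ~ r(s - pi)], which splits into
   [e'' ~ e] for the [pi]-periodic part and [o'' ~ - o] for the [pi]-antiperiodic part. *)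
Require Import Defs.
From Stdlib Require Import Reals ZArith Lra Lia.
From Coquelicot Require Import Coquelicot.
Open Scope R_scope.

(** * Calculus of periodic functions *)

Lemma dlim_eq (w : R -> R) (s l l' : R) :
  derivable_pt_lim w s l -> l = l' -> derivable_pt_lim w s l'.
Proof. now intros H <-. Qed.

Lemma dlim_ext (v w : R -> R) (s l : R) :
  (forall u, v u = w u) -> derivable_pt_lim v s l -> derivable_pt_lim w s l.
Proof.
  intros E H e he. destruct (H e he) as [d Hd]. exists d.
  intros h h0 hd. rewrite <- !E. now apply Hd.
Qed.

Lemma dlim_plus (v w : R -> R) (s l l' : R) :
  derivable_pt_lim v s l -> derivable_pt_lim w s l' ->
  derivable_pt_lim (fun u => v u + w u) s (l + l').
Proof. exact (derivable_pt_lim_plus v w s l l'). Qed.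

Lemma dlim_minus (v w : R -> R) (s l l' : R) :
  derivable_pt_lim v s l -> derivable_pt_lim w s l' ->
  derivable_pt_lim (fun u => v u - w u) s (l - l').
Proof. exact (derivable_pt_lim_minus v w s l l'). Qed.

Lemma dlim_mult (v w : R -> R) (s l l' : R) :
  derivable_pt_lim v s l -> derivable_pt_lim w s l' ->
  derivable_pt_lim (fun u => v u * w u) s (l * w s + v s * l').
Proof. exact (derivable_pt_lim_mult v w s l l'). Qed.

Lemma dlim_scal (c : R) (w : R -> R) (s l : R) :
  derivable_pt_lim w s l -> derivable_pt_lim (fun u => c * w u) s (c * l).
Proof. exact (derivable_pt_lim_scal w c s l). Qed.

Lemma dlim_comp (v w : R -> R) (s l l' : R) :
  derivable_pt_lim w s l -> derivable_pt_lim v (w s) l' ->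
  derivable_pt_lim (fun u => v (w u)) s (l' * l).
Proof. exact (derivable_pt_lim_comp w v s l l'). Qed.

Lemma dlim_shift (w : R -> R) (a s l : R) :
  derivable_pt_lim w (s - a) l -> derivable_pt_lim (fun u => w (u - a)) s l.
Proof.
  intros H. apply dlim_eq with (l * (1 - 0)); [|ring].
  apply (dlim_comp w (fun u => u - a)); [|exact H].
  apply dlim_minus; [apply derivable_pt_lim_id | apply derivable_pt_lim_const].
Qed.

Lemma dlim_continuity (w w' : R -> R) :
  (forall s, derivable_pt_lim w s (w' s)) -> continuity w.
Proof. intros H s. apply derivable_continuous_pt. exists (w' s). apply H. Qed.

Lemma mvt_bound (w w' : R -> R) (a b K : R) :
  a <= b -> (forall s, a <= s <= b -> derivable_pt_lim w s (w' s)) ->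
  (forall s, a <= s <= b -> Rabs (w' s) <= K) ->
  Rabs (w b - w a) <= K * (b - a).
Proof.
  intros hab Hd Hb. destruct (Req_dec a b) as [<-|hne].
  - rewrite !Rminus_diag, Rabs_R0. lra.
  - destruct (MVT_cor2 w w' a b) as [c [E hc]]; [lra|exact Hd|].
    rewrite E, Rabs_mult, (Rabs_pos_eq (b - a)); [|lra].
    apply Rmult_le_compat_r; [lra|]. apply Hb. lra.
Qed.

Lemma mvt_bound_abs (w w' : R -> R) (a b K : R) :
  (forall s, derivable_pt_lim w s (w' s)) -> (forall s, Rabs (w' s) <= K) ->
  Rabs (w b - w a) <= K * Rabs (b - a).
Proof.
  intros Hd Hb. destruct (Rle_dec a b) as [h|h].
  - rewrite (Rabs_pos_eq (b - a)); [|lra]. now apply mvt_bound with w'.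
  - rewrite Rabs_minus_sym, (Rabs_minus_sym b a), (Rabs_pos_eq (a - b)); [|lra].
    apply mvt_bound with w'; auto. lra.
Qed.

Lemma cont_const (c : R) : continuity (fun _ => c).
Proof. intros s. apply continuity_pt_const. now intros u v. Qed.
Lemma cont_plus (v w : R -> R) :
  continuity v -> continuity w -> continuity (fun s => v s + w s).
Proof. exact (continuity_plus v w). Qed.
Lemma cont_minus (v w : R -> R) :
  continuity v -> continuity w -> continuity (fun s => v s - w s).
Proof. exact (continuity_minus v w). Qed.
Lemma cont_mult (v w : R -> R) :
  continuity v -> continuity w -> continuity (fun s => v s * w s).
Proof. exact (continuity_mult v w). Qed.
Lemma cont_pow (w : R -> R) (n : nat) :
  continuity w -> continuity (fun s => w s ^ n).
Proof.
  intros H. induction n as [|n IH]; simpl; [apply cont_const|now apply cont_mult].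
Qed.
Lemma cont_comp (v w : R -> R) :
  continuity v -> continuity w -> continuity (fun s => v (w s)).
Proof. intros Hv Hw. exact (continuity_comp w v Hw Hv). Qed.
Lemma cont_id : continuity (fun s => s).
Proof. exact (derivable_continuous _ derivable_id). Qed.

Ltac cont := repeat first
  [ assumption | apply cont_const | apply cont_id
  | apply cont_minus | apply cont_plus | apply cont_mult | apply cont_pow
  | apply (cont_comp sin); [exact continuity_sin|]
  | apply (cont_comp cos); [exact continuity_cos|]
  | match goal with
    | H : continuity ?w |- continuity (fun s => ?w _) => apply (cont_comp w _ H)
    end ].

Definition per (w : R -> R) : Prop := is_period w (2 * PI).

Lemma is_period_IZR (w : R -> R) (T : R) :
  is_period w T -> forall (n : Z) (s : R), w (s + IZR n * T) = w s.
Proof.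
  intros H.
  assert (HN : forall (n : nat) s, w (s + INR n * T) = w s).
  { induction n as [|n IH]; intros s.
    - simpl. f_equal. ring.
    - rewrite S_INR, <- (IH s), <- (H (s + INR n * T)). f_equal. ring. }
  intros n s. destruct (Z_le_gt_dec 0 n) as [h|h].
  - rewrite <- (Z2Nat.id n), <- INR_IZR_INZ by lia. apply HN.
  - rewrite <- (HN (Z.to_nat (- n)) (s + IZR n * T)). f_equal.
    rewrite INR_IZR_INZ, Z2Nat.id by lia. rewrite opp_IZR. ring.
Qed.

Lemma per_reduce (w : R -> R) :
  per w -> forall s, exists u, 0 <= u <= 2 * PI /\ w s = w u.
Proof.
  intros H s. pose proof PI_RGT_0 as hpi.
  destruct (archimed (s / (2 * PI))) as [h1 h2].
  set (n := up (s / (2 * PI))) in *.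
  assert (E : s / (2 * PI) * (2 * PI) = s) by (field; lra).
  exists (s + IZR (1 - n) * (2 * PI)). split.
  - rewrite minus_IZR. nra.
  - symmetry. now apply is_period_IZR.
Qed.

Lemma per_max (w : R -> R) :
  per w -> continuity w -> exists s0, forall s, w s <= w s0.
Proof.
  intros Hp Hc. pose proof PI_RGT_0.
  destruct (continuity_ab_maj w 0 (2 * PI)) as [s0 [Hs _]]; [lra|intros; apply Hc|].
  exists s0. intros s. destruct (per_reduce w Hp s) as [u [hu ->]]. now apply Hs.
Qed.

Lemma per_abs_max (w : R -> R) :
  per w -> continuity w -> exists s0, forall s, Rabs (w s) <= Rabs (w s0).
Proof.
  intros Hp Hc. apply (per_max (fun s => Rabs (w s))).
  - intros s. now rewrite Hp.
  - apply (cont_comp Rabs); [exact Rcontinuity_abs|exact Hc].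
Qed.

(* At an extremum of [w] the derivative vanishes, so the equation itself bounds [w]. *)
Lemma per_resolvent (w d : R -> R) (a K : R) :
  per w -> (forall s, derivable_pt_lim w s (a * w s + d s)) ->
  Rabs a = 1 -> (forall s, Rabs (d s) <= K) ->
  forall s, Rabs (w s) <= K.
Proof.
  intros Hp Hd Ha HK s.
  assert (Hc : continuity w) by (eapply dlim_continuity; exact Hd).
  assert (crit : forall s0, (forall s, w s <= w s0) \/ (forall s, w s0 <= w s) ->
             Rabs (w s0) <= K).
  { intros s0 H0.
    assert (E : a * w s0 + d s0 = 0).
    { pose (pr := exist _ _ (Hd s0) : derivable_pt w s0).
      change (derive_pt w s0 pr = 0).
      destruct H0 as [H0|H0].
      - apply deriv_maximum with (s0 - 1) (s0 + 1); try lra. intros; apply H0.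
      - apply deriv_minimum with (s0 - 1) (s0 + 1); try lra. intros; apply H0. }
    replace (Rabs (w s0)) with (Rabs (d s0)); [apply HK|].
    replace (d s0) with (- (a * w s0)) by lra.
    rewrite Rabs_Ropp, Rabs_mult, Ha. ring. }
  destruct (per_max w Hp Hc) as [s1 H1].
  destruct (per_max (fun s => - w s)) as [s2 H2].
  { intros u. now rewrite Hp. }
  { exact (continuity_opp w Hc). }
  pose proof (crit s1 (or_introl H1)) as C1.
  assert (C2 : Rabs (w s2) <= K).
  { apply crit. right. intros u. specialize (H2 u). lra. }
  specialize (H1 s). specialize (H2 s). cbv beta in H2.
  apply Rabs_le. apply Rabs_le_between in C1, C2. lra.
Qed.

(** * Integrals over one period *)

Definition J (w : R -> R) : R := RInt w 0 (2 * PI).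

Lemma ex_J (w : R -> R) (a b : R) : continuity w -> ex_RInt w a b.
Proof.
  intros H. apply (@ex_RInt_continuous R_CompleteNormedModule). intros s _.
  apply continuity_pt_filterlim, H.
Qed.

Lemma J_ext (v w : R -> R) : (forall s, v s = w s) -> J v = J w.
Proof. intros H. apply RInt_ext. intros; apply H. Qed.

Lemma per_diff (w w' : R -> R) :
  per w -> (forall s, derivable_pt_lim w s (w' s)) -> per w'.
Proof.
  intros Hp Hd s. apply (uniqueness_limite w s); [|apply Hd].
  apply dlim_ext with (fun u => w (u - - (2 * PI))).
  - intros u. unfold Rminus. rewrite Ropp_involutive. apply Hp.
  - apply dlim_shift. unfold Rminus. rewrite Ropp_involutive. apply Hd.
Qed.

Lemma J_plus (v w : R -> R) :
  continuity v -> continuity w -> J (fun s => v s + w s) = J v + J w.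
Proof. intros Hv Hw. apply (RInt_plus v w); now apply ex_J. Qed.

Lemma J_minus (v w : R -> R) :
  continuity v -> continuity w -> J (fun s => v s - w s) = J v - J w.
Proof. intros Hv Hw. apply (RInt_minus v w); now apply ex_J. Qed.

Lemma J_scal (c : R) (w : R -> R) :
  continuity w -> J (fun s => c * w s) = c * J w.
Proof. intros Hw. apply (RInt_scal w 0 (2 * PI) c). now apply ex_J. Qed.

Lemma J_bound (w : R -> R) (K : R) :
  continuity w -> (forall s, Rabs (w s) <= K) -> Rabs (J w) <= 2 * PI * K.
Proof.
  intros Hc H. pose proof PI_RGT_0.
  replace (2 * PI * K) with ((2 * PI - 0) * K) by ring.
  apply abs_RInt_le_const; [lra|now apply ex_J|intros; apply H].
Qed.

Lemma J_primitive (W w : R -> R) :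
  (forall s, derivable_pt_lim W s (w s)) -> continuity w ->
  J w = W (2 * PI) - W 0.
Proof.
  intros HD Hc. apply is_RInt_unique. apply (is_RInt_derive W w).
  - intros s _. now apply is_derive_Reals.
  - intros s _. apply continuity_pt_filterlim, Hc.
Qed.

Lemma J_shift (w : R -> R) (a : R) :
  per w -> continuity w -> J (fun s => w (s - a)) = J w.
Proof.
  intros Hp Hc. unfold J.
  assert (HL : forall c d e, RInt (fun s => w (s + e)) c d = RInt w (c + e) (d + e)).
  { intros c d e.
    pose proof (@RInt_comp_lin R_CompleteNormedModule w 1 e c d (ex_J _ _ _ Hc)) as E.
    rewrite !Rmult_1_l in E. rewrite <- E. apply RInt_ext. intros s _.
    change (w (s + e) = 1 * w (1 * s + e)). now rewrite !Rmult_1_l. }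
  unfold Rminus. generalize (- a). clear a; intros a.
  rewrite HL, Rplus_0_l.
  assert (E : RInt w (2 * PI) (2 * PI + a) = RInt w 0 a).
  { replace (RInt w 0 a) with (RInt (fun s => w (s + 2 * PI)) 0 a).
    - rewrite HL. f_equal; ring.
    - apply RInt_ext. intros; apply Hp. }
  pose proof (RInt_Chasles w 0 a (2 * PI + a)) as C1.
  pose proof (RInt_Chasles w 0 (2 * PI) (2 * PI + a)) as C2.
  specialize (C1 (ex_J _ _ _ Hc) (ex_J _ _ _ Hc)).
  specialize (C2 (ex_J _ _ _ Hc) (ex_J _ _ _ Hc)).
  unfold plus in C1, C2; simpl in C1, C2. rewrite E in C2. lra.
Qed.

Lemma J_near (v w : R -> R) (K : R) :
  continuity v -> continuity w -> (forall s, Rabs (v s - w s) <= K) ->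
  Rabs (J v - J w) <= 2 * PI * K.
Proof.
  intros Hv Hw H. rewrite <- J_minus by assumption.
  apply J_bound; [now apply cont_minus|exact H].
Qed.

(** Integrates through the explicit primitive [W]; the derivative check is a polynomial identity in
    [sin] and [cos] modulo [cos s ^ 2 = 1 - sin s ^ 2]. *)
Ltac trig_primitive W :=
  rewrite (J_primitive W);
  [ rewrite ?sin_2PI, ?cos_2PI, ?sin_0, ?cos_0; field
  | let s := fresh "s" in
    intros s; apply is_derive_Reals; auto_derive; [exact I|]; simpl;
    assert (E : cos s ^ 2 = 1 - sin s ^ 2)
      by (pose proof (sin2_cos2 s); unfold Rsqr in *; lra);
    field [E]
  | cont ].
Lemma J_1 : J (fun _ => 1) = 2 * PI.
Proof. trig_primitive (fun s : R => s). Qed.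
Lemma J_sin : J sin = 0.
Proof. trig_primitive (fun s : R => - cos s). Qed.
Lemma J_sin2 : J (fun s => sin s ^ 2) = PI.
Proof. trig_primitive (fun s : R => (s - sin s * cos s) / 2).  Qed.
Lemma J_sin3 : J (fun s => sin s ^ 3) = 0.
Proof. trig_primitive (fun s : R => - cos s + cos s ^ 3 / 3). Qed.
Lemma J_sin4 : J (fun s => sin s ^ 4) = 3 * PI / 4.
Proof.
  trig_primitive (fun s : R => 3 * s / 8 - 3 * (sin s * cos s) / 8 - sin s ^ 3 * cos s / 4).
Qed.
Lemma J_sin_cos : J (fun s => sin s * cos s) = 0.
Proof. trig_primitive (fun s : R => sin s ^ 2 / 2). Qed.
Lemma J_sin2_cos : J (fun s => sin s ^ 2 * cos s) = 0.
Proof. trig_primitive (fun s : R => sin s ^ 3 / 3). Qed.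
Lemma J_sin3_cos : J (fun s => sin s ^ 3 * cos s) = 0.
Proof. trig_primitive (fun s : R => sin s ^ 4 / 4). Qed.

(** * Harmonic oscillators and Fourier modes *)

Lemma abs_plus_le (u v a b : R) : Rabs u <= a -> Rabs v <= b -> Rabs (u + v) <= a + b.
Proof. intros. pose proof (Rabs_triang u v). lra. Qed.
Lemma abs_minus_le (u v a b : R) : Rabs u <= a -> Rabs v <= b -> Rabs (u - v) <= a + b.
Proof. intros. unfold Rminus. apply abs_plus_le; [|rewrite Rabs_Ropp]; assumption. Qed.
Lemma abs_mult_le (u v a b : R) : Rabs u <= a -> Rabs v <= b -> Rabs (u * v) <= a * b.
Proof. intros. rewrite Rabs_mult. apply Rmult_le_compat; auto using Rabs_pos. Qed.
Lemma abs_opp_le (u a : R) : Rabs u <= a -> Rabs (- u) <= a.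
Proof. now rewrite Rabs_Ropp. Qed.
Lemma abs_sin_le (s : R) : Rabs (sin s) <= 1.
Proof. apply Rabs_le, SIN_bound. Qed.
Lemma abs_cos_le (s : R) : Rabs (cos s) <= 1.
Proof. apply Rabs_le, COS_bound. Qed.

(* [bound] proves [Rabs e <= ?K] structurally, building [K] from the bounds on the atoms of [e]. *)
Ltac bound_atom := first
  [ eassumption | apply abs_sin_le | apply abs_cos_le
  | match goal with H : forall s, Rabs _ <= _ |- _ => apply H end ].
Ltac bound := first
  [ bound_atom
  | apply abs_minus_le; bound | apply abs_plus_le; bound | apply abs_opp_le; bound
  | apply abs_mult_le; bound | apply Rle_refl ].

Ltac dlim := repeat first
  [ match goal with
    | H : forall s, derivable_pt_lim _ s _ |- derivable_pt_lim _ _ _ => apply H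
    end
  | apply derivable_pt_lim_sin | apply derivable_pt_lim_cos
  | apply derivable_pt_lim_const
  | apply dlim_shift | apply dlim_minus | apply dlim_plus | apply dlim_scal | apply dlim_mult
  ].

Lemma per_sin : per sin.
Proof. intros s. now rewrite sin_plus, sin_2PI, cos_2PI, Rmult_1_r, Rmult_0_r, Rplus_0_r. Qed.
Lemma per_cos : per cos.
Proof. intros s. rewrite cos_plus, sin_2PI, cos_2PI. ring. Qed.
Lemma sin_minus_PI (s : R) : sin (s - PI) = - sin s.
Proof. rewrite sin_minus, sin_PI, cos_PI. ring. Qed.
Lemma cos_minus_PI (s : R) : cos (s - PI) = - cos s.
Proof. rewrite cos_minus, sin_PI, cos_PI. ring. Qed.
Lemma per_shift (w : R -> R) (a : R) : per w -> per (fun s => w (s - a)).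
Proof. intros H s. rewrite <- (H (s - a)). f_equal. ring. Qed.

Lemma J_derivative (w w' : R -> R) :
  per w -> (forall s, derivable_pt_lim w s (w' s)) -> continuity w' -> J w' = 0.
Proof.
  intros Hp Hd Hc. rewrite (J_primitive w w' Hd Hc).
  rewrite <- (Rplus_0_l (2 * PI)), Hp. ring.
Qed.

Lemma J_const (c : R) : J (fun _ => c) = 2 * PI * c.
Proof.
  rewrite <- (J_ext (fun s => c * 1)); [|intros; ring].
  rewrite (J_scal c (fun _ => 1)), J_1; [ring|cont].
Qed.

(** All values of [u] are attained on one period, so its oscillation is at most [2 * PI * K], and a
    function deviates from its mean by at most its oscillation. *)
Lemma zero_mean_bound (u u' : R -> R) (K : R) :
  per u -> (forall s, derivable_pt_lim u s (u' s)) -> (forall s, Rabs (u' s) <= K) ->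
  J u = 0 -> forall s, Rabs (u s) <= 2 * PI * K.
Proof.
  intros Hp Hd HK HJ s. pose proof PI_RGT_0.
  assert (Hc : continuity u) by (eapply dlim_continuity; exact Hd).
  assert (K0 : 0 <= K) by (pose proof (HK 0); pose proof (Rabs_pos (u' 0)); lra).
  assert (Hosc : forall v w, Rabs (u v - u w) <= 2 * PI * K).
  { intros v w.
    destruct (per_reduce u Hp v) as [v0 [hv ->]], (per_reduce u Hp w) as [w0 [hw ->]].
    eapply Rle_trans; [now apply (mvt_bound_abs u u' w0 v0 K)|].
    rewrite Rmult_comm. apply Rmult_le_compat_r; [exact K0|]. apply Rabs_le. lra. }
  assert (E : Rabs (J (fun _ => u s) - J u) <= 2 * PI * (2 * PI * K)).
  { apply J_near; [cont|cont|]. intros v. apply Hosc. }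
  rewrite HJ, J_const, Rminus_0_r, Rabs_mult, (Rabs_pos_eq (2 * PI)) in E by lra.
  apply Rmult_le_reg_l with (2 * PI); lra.
Qed.

Section Oscillator.
Variables (z z1 d : R -> R) (K : R).
Hypothesis Hper : per z.
Hypothesis Hz : forall s, derivable_pt_lim z s (z1 s).
Hypothesis Hd : forall s, Rabs (d s) <= K.

(** The operator [D^2 - 1] factors: [w = z' + z] solves [w' = w + d], and [z' = - z + w]. Each
    first-order factor has a periodic inverse of norm at most 1 by [per_resolvent]. *)
Lemma hyperbolic_bound :
  (forall s, derivable_pt_lim z1 s (z s + d s)) -> forall s, Rabs (z s) <= K.
Proof.
  intros Hz1.
  apply (per_resolvent z (fun s => z1 s + z s) (-1)).
  - exact Hper.
  - intros s. eapply dlim_eq; [apply Hz|]. cbv beta. ring.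
  - unfold Rabs; destruct (Rcase_abs (-1)); lra.
  - apply (per_resolvent _ d 1).
    + intros s. now rewrite (per_diff z z1 Hper Hz), Hper.
    + intros s. eapply dlim_eq; [dlim|]. cbv beta. ring.
    + apply Rabs_R1.
    + exact Hd.
Qed.

(* [z cos - z' sin] and [z sin + z' cos] have small derivatives, and have mean zero when [z] has
   no first harmonic. *)
Lemma elliptic_bound :
  (forall s, derivable_pt_lim z1 s (- z s + d s)) ->
  J (fun s => z s * cos s) = 0 -> J (fun s => z s * sin s) = 0 ->
  forall s, Rabs (z s) <= 4 * PI * K.
Proof.
  intros Hz1 Hcos Hsin s.
  assert (Hc : continuity z) by (eapply dlim_continuity; exact Hz).
  assert (Hc1 : continuity z1) by (eapply dlim_continuity; exact Hz1).
  assert (Hp1 := per_diff z z1 Hper Hz).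
  assert (Hcs := continuity_sin). assert (Hcc := continuity_cos).
  assert (Hu : forall s, Rabs (z s * cos s - z1 s * sin s) <= 2 * PI * K).
  { apply (zero_mean_bound (fun s => z s * cos s - z1 s * sin s) (fun s => - (d s * sin s))).
    - intros v. now rewrite Hper, Hp1, per_sin, per_cos.
    - intros v. eapply dlim_eq; [dlim|]. cbv beta. ring.
    - intros v. eapply Rle_trans; [bound|lra].
    (* The integrand is the derivative of [z sin]. Since [J (z cos) = 0], this also gives
       [J (z' sin) = 0], so [z cos - z' sin] has mean zero. *)
    - assert (E : J (fun s => z1 s * sin s + z s * cos s) = 0).
      { apply J_derivative with (fun s => z s * sin s).
        + intros v. now rewrite Hper, per_sin.
        + intros v. dlim.
        + cont. }
      rewrite J_plus in E by cont. rewrite J_minus by cont. lra. }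
  assert (Hv : forall s, Rabs (z s * sin s + z1 s * cos s) <= 2 * PI * K).
  { apply (zero_mean_bound (fun s => z s * sin s + z1 s * cos s) (fun s => d s * cos s)).
    - intros v. now rewrite Hper, Hp1, per_sin, per_cos.
    - intros v. eapply dlim_eq; [dlim|]. cbv beta. ring.
    - intros v. eapply Rle_trans; [bound|lra].
    - assert (E : J (fun s => z1 s * cos s - z s * sin s) = 0).
      { apply J_derivative with (fun s => z s * cos s).
        + intros v. now rewrite Hper, per_cos.
        + intros v. eapply dlim_eq; [dlim|]. cbv beta. ring.
        + cont. }
      rewrite J_minus in E by cont. rewrite J_plus by cont. lra. }
  replace (z s) with
    ((z s * cos s - z1 s * sin s) * cos s + (z s * sin s + z1 s * cos s) * sin s).
  - eapply Rle_trans.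
    + apply abs_plus_le; (apply abs_mult_le; [|bound]); [apply Hu|apply Hv].
    + lra.
  - pose proof (sin2_cos2 s) as E. unfold Rsqr in E.
    transitivity (z s * (sin s * sin s + cos s * cos s)); [ring|rewrite E; ring].
Qed.
End Oscillator.

(** The sum and the difference of [r] and its half-period shift decouple the equation: the sum
    solves a hyperbolic equation, the difference an elliptic one, each with a forcing of size at
    most [2 * K]. *)
Lemma half_period_shift_bound (r r1 d : R -> R) (K : R) :
  per r -> (forall s, derivable_pt_lim r s (r1 s)) ->
  (forall s, derivable_pt_lim r1 s (r (s - PI) + d s)) ->
  (forall s, Rabs (d s) <= K) ->
  J (fun s => r s * cos s) = 0 -> J (fun s => r s * sin s) = 0 ->
  forall s, Rabs (r s) <= 17 * K.
Proof.
  intros Hp Hr Hr1 Hd Hcos Hsin s.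
  assert (Hc : continuity r) by (eapply dlim_continuity; exact Hr).
  assert (Hcs := continuity_sin). assert (Hcc := continuity_cos).
  assert (K0 : 0 <= K) by (pose proof (Hd 0); pose proof (Rabs_pos (d 0)); lra).
  assert (H2 : forall u, r (u - PI - PI) = r u).
  { intros u. rewrite <- (Hp (u - PI - PI)). f_equal. ring. }
  assert (He : Rabs (r s + r (s - PI)) <= K + K).
  { apply (hyperbolic_bound (fun s => r s + r (s - PI)) (fun s => r1 s + r1 (s - PI))
             (fun s => d s + d (s - PI))).
    - intros u. rewrite Hp. f_equal. apply (per_shift r PI Hp).
    - intros u. dlim.
    - intros u. bound.
    - intros u. eapply dlim_eq; [dlim|]. rewrite H2. ring. }
  assert (Ho : Rabs (r s - r (s - PI)) <= 4 * PI * (K + K)).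
  { apply (elliptic_bound (fun s => r s - r (s - PI)) (fun s => r1 s - r1 (s - PI))
             (fun s => d s - d (s - PI))).
    - intros u. rewrite Hp. f_equal. apply (per_shift r PI Hp).
    - intros u. dlim.
    - intros u. bound.
    - intros u. eapply dlim_eq; [dlim|]. rewrite H2. ring.
    (* The first harmonics change sign under the shift by [PI], so the difference inherits the
       orthogonality of [r] to them. *)
    - rewrite <- (J_ext (fun s => r s * cos s + r (s - PI) * cos (s - PI))).
      2:{ intros u. rewrite cos_minus_PI. ring. }
      rewrite J_plus by cont. rewrite (J_shift (fun s => r s * cos s)).
      + lra. + intros u. now rewrite Hp, per_cos. + cont.
    - rewrite <- (J_ext (fun s => r s * sin s + r (s - PI) * sin (s - PI))).
      2:{ intros u. rewrite sin_minus_PI. ring. }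
      rewrite J_plus by cont. rewrite (J_shift (fun s => r s * sin s)).
      + lra. + intros u. now rewrite Hp, per_sin. + cont. }
  (* Half the sum of both bounds is [(1 + 4 * PI) * K], and [PI <= 4] gives the factor 17. *)
  pose proof PI_4. apply Rabs_le_between in He, Ho. apply Rabs_le. nra.
Qed.

(** * Fourier coefficients of the delay equation *)

Section Modes.
Variables (y F : R -> R) (lam tau : R).
Hypothesis Hper : per y.
Hypothesis HF : continuity F.
Hypothesis Hy : forall s, derivable_pt_lim y s (- lam * F (y (s - tau))).

(** Real form of [i n y_n = - lam e^(- i n tau) F_n], where [y_n] and [F_n] are the [n]th Fourier
    coefficients of [y] and [F o y]. The derivative of [y] times a harmonic integrates to zero, and
    translating by [tau] moves the delay into the harmonic. *)
Lemma fourier_mode (n : R) :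
  per (fun s => cos (n * s)) -> per (fun s => sin (n * s)) ->
  n * J (fun s => y s * sin (n * s)) =
    - lam * (cos (n * tau) * J (fun s => F (y s) * cos (n * s))
             - sin (n * tau) * J (fun s => F (y s) * sin (n * s))) /\
  - n * J (fun s => y s * cos (n * s)) =
    - lam * (cos (n * tau) * J (fun s => F (y s) * sin (n * s))
             + sin (n * tau) * J (fun s => F (y s) * cos (n * s))).
Proof.
  intros Pc Ps.
  assert (Hc : continuity y) by (eapply dlim_continuity; exact Hy).
  assert (Dc : forall s, derivable_pt_lim (fun s => cos (n * s)) s (- n * sin (n * s))).
  { intros s. eapply dlim_eq.
    - apply (dlim_comp cos (fun s => n * s)); [|apply derivable_pt_lim_cos].
      apply dlim_scal, derivable_pt_lim_id.
    - ring. }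
  assert (Ds : forall s, derivable_pt_lim (fun s => sin (n * s)) s (n * cos (n * s))).
  { intros s. eapply dlim_eq.
    - apply (dlim_comp sin (fun s => n * s)); [|apply derivable_pt_lim_sin].
      apply dlim_scal, derivable_pt_lim_id.
    - ring. }
  assert (HFy : continuity (fun s => F (y s))) by cont.
  split.
  - assert (E : J (fun s => - lam * F (y (s - tau)) * cos (n * s) + - n * (y s * sin (n * s))) = 0).
    { apply J_derivative with (fun s => y s * cos (n * s)).
      + intros s. now rewrite Hper, Pc.
      + intros s. eapply dlim_eq; [apply dlim_mult; [apply Hy|apply Dc]|]. cbv beta. ring.
      + cont. }
    rewrite J_plus, J_scal in E by cont.
    pose (Q := fun u => - lam * (cos (n * tau) * (F (y u) * cos (n * u))
                                 - sin (n * tau) * (F (y u) * sin (n * u)))).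
    rewrite (J_ext _ (fun s => Q (s - tau))) in E.
    2:{ intros s. unfold Q. replace (n * s) with (n * (s - tau) + n * tau) by ring.
        rewrite cos_plus. ring. }
    rewrite (J_shift Q) in E; unfold Q.
    + unfold Q in E. rewrite J_scal, J_minus, !J_scal in E by cont. lra.
    + intros s. now rewrite Hper, Pc, Ps.
    + cont.
  - assert (E : J (fun s => - lam * F (y (s - tau)) * sin (n * s) + n * (y s * cos (n * s))) = 0).
    { apply J_derivative with (fun s => y s * sin (n * s)).
      + intros s. now rewrite Hper, Ps.
      + intros s. eapply dlim_eq; [apply dlim_mult; [apply Hy|apply Ds]|]. cbv beta. ring.
      + cont. }
    rewrite J_plus, J_scal in E by cont.
    pose (Q := fun u => - lam * (cos (n * tau) * (F (y u) * sin (n * u))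
                                 + sin (n * tau) * (F (y u) * cos (n * u)))).
    rewrite (J_ext _ (fun s => Q (s - tau))) in E.
    2:{ intros s. unfold Q. replace (n * s) with (n * (s - tau) + n * tau) by ring.
        rewrite sin_plus. ring. }
    rewrite (J_shift Q) in E; unfold Q.
    + unfold Q in E. rewrite J_scal, J_plus, !J_scal in E by cont. lra.
    + intros s. now rewrite Hper, Pc, Ps.
    + cont.
Qed.
End Modes.

Section LowModes.
Variables (y F : R -> R) (lam tau : R).
Hypothesis Hper : per y.
Hypothesis HF : continuity F.
Hypothesis Hy : forall s, derivable_pt_lim y s (- lam * F (y (s - tau))).

Lemma fourier_mode_1 :
  J (fun s => y s * sin s) =
    - lam * (cos tau * J (fun s => F (y s) * cos s) - sin tau * J (fun s => F (y s) * sin s)) /\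
  - J (fun s => y s * cos s) =
    - lam * (cos tau * J (fun s => F (y s) * sin s) + sin tau * J (fun s => F (y s) * cos s)).
Proof.
  assert (E : forall v w : R -> R,
            J (fun s => v s * w (1 * s)) = J (fun s => v s * w s)).
  { intros v w. apply J_ext. intros s. now rewrite Rmult_1_l. }
  destruct (fourier_mode y F lam tau Hper HF Hy 1) as [E1 E2].
  - intros s. now rewrite !Rmult_1_l, per_cos.
  - intros s. now rewrite !Rmult_1_l, per_sin.
  - rewrite !E, !Rmult_1_l in E1. rewrite !E, !Rmult_1_l in E2. split; lra.
Qed.

Lemma fourier_mode_2 :
  2 * J (fun s => y s * sin (2 * s)) =
    - lam * (cos (2 * tau) * J (fun s => F (y s) * cos (2 * s))
             - sin (2 * tau) * J (fun s => F (y s) * sin (2 * s))) /\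
  - 2 * J (fun s => y s * cos (2 * s)) =
    - lam * (cos (2 * tau) * J (fun s => F (y s) * sin (2 * s))
             + sin (2 * tau) * J (fun s => F (y s) * cos (2 * s))).
Proof.
  apply fourier_mode; try assumption; intros s.
  - replace (2 * (s + 2 * PI)) with (2 * s + 2 * PI + 2 * PI) by ring. now rewrite !per_cos.
  - replace (2 * (s + 2 * PI)) with (2 * s + 2 * PI + 2 * PI) by ring. now rewrite !per_sin.
Qed.

Lemma fourier_mode_0 : lam <> 0 -> J (fun s => F (y s)) = 0.
Proof.
  intros hl.
  assert (Hc : continuity y) by (eapply dlim_continuity; exact Hy).
  assert (E : J (fun s => - lam * F (y (s - tau))) = 0).
  { apply J_derivative with y; [assumption|assumption|cont]. }
  rewrite J_scal, (J_shift (fun s => F (y s))) in E.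
  - apply Rmult_integral in E as [E|E]; [lra|exact E].
  - intros s. now rewrite Hper.
  - cont.
  - cont.
Qed.
End LowModes.

(** * The remainder after the first harmonic *)

Section Remainder.
Variables (f f1 y : R -> R) (lam tau L M eps : R).
Hypothesis Hf : forall x, derivable_pt_lim f x (f1 x).
Hypothesis Hg : forall x, Rabs x <= M -> Rabs (f x - x) <= L * M ^ 2.
Hypothesis Hg1 : forall x, Rabs x <= M -> Rabs (f1 x - 1) <= L * M.
Hypothesis HL : 0 <= L.
Hypothesis HLM : L * M <= 1.
Hypothesis Hper : per y.
Hypothesis Hy : forall s, derivable_pt_lim y s (- lam * f (y (s - tau))).
Hypothesis HM : forall s, Rabs (y s) <= M.
Hypothesis Hlam : Rabs (lam - 1) <= eps.
Hypothesis Htau : Rabs (tau - PI / 2) <= eps.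
Hypothesis Heps : eps <= / 400.
Hypothesis Hcos : J (fun s => y s * cos s) = 0.

Let b := J (fun s => y s * sin s) / PI.
Let r (s : R) := y s - b * sin s.
(** [al cos + be sin] is the residual of [b sin] in the linearized equation [y' = - lam y(. - tau)].
    Hence [r' = - lam r(. - tau) + h], where [h] collects this residual and the nonlinear part of
    [f]. *)
Let al := b * (1 - lam * sin tau).
Let be := b * lam * cos tau.
Let h (s : R) := - lam * (f (y (s - tau)) - y (s - tau)) - al * cos s - be * sin s.
Let y1 (s : R) := - lam * f (y (s - tau)).
Let h1 (s : R) :=
  - lam * ((f1 (y (s - tau)) - 1) * y1 (s - tau)) + al * sin s - be * cos s.
Let r1 (s : R) := - lam * r (s - tau) + h s.

Let cont_f : continuity f.
Proof. eapply dlim_continuity; exact Hf. Qed.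
Let cont_y : continuity y.
Proof. eapply dlim_continuity; exact Hy. Qed.
Let M_nonneg : 0 <= M.
Proof. pose proof (HM 0). pose proof (Rabs_pos (y 0)). lra. Qed.
Let LM2 : 0 <= L * M ^ 2.
Proof. apply Rmult_le_pos; [exact HL|apply pow_le, M_nonneg]. Qed.
Let eps_nonneg : 0 <= eps.
Proof. pose proof (Rabs_pos (lam - 1)). lra. Qed.
Let lam_le : Rabs lam <= 1.01.
Proof. apply Rabs_le_between in Hlam. apply Rabs_le. lra. Qed.

(** The closeness of [lam] to 1 and of [tau] to [PI / 2] alone would only give a bound of order
    [eps * |b|]. The first-mode equations express [al] and [be] through the coefficients of
    [f(y) - y], which are quadratic in [M]. *)
Lemma first_mode_residual : Rabs al <= 5 * (L * M ^ 2) /\ Rabs be <= 5 * (L * M ^ 2).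
Proof.
  pose proof PI_RGT_0 as hpi. pose proof continuity_sin as Cs. pose proof continuity_cos as Cc.
  destruct (fourier_mode_1 y f lam tau Hper cont_f Hy) as [E1 E2].
  set (Gs := J (fun s => (f (y s) - y s) * sin s)).
  set (Gc := J (fun s => (f (y s) - y s) * cos s)).
  assert (Es : J (fun s => f (y s) * sin s) = PI * b + Gs).
  { unfold b, Gs. replace (PI * (J (fun s => y s * sin s) / PI))
      with (J (fun s => y s * sin s)) by (field; lra).
    rewrite <- J_plus by cont. apply J_ext. intros s. ring. }
  assert (Ec : J (fun s => f (y s) * cos s) = Gc).
  { rewrite <- (Rplus_0_l Gc), <- Hcos. unfold Gc.
    rewrite <- J_plus by cont. apply J_ext. intros s. ring. }
  rewrite Es, Ec in E1, E2. rewrite Hcos in E2.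
  replace (J (fun s => y s * sin s)) with (PI * b) in E1 by (unfold b; field; lra).
  assert (HG : forall s, Rabs (f (y s) - y s) <= L * M ^ 2) by (intros; apply Hg, HM).
  assert (BGs : Rabs Gs <= 2 * PI * (L * M ^ 2 * 1)).
  { apply J_bound; [cont|intros s; apply abs_mult_le; bound]. }
  assert (BGc : Rabs Gc <= 2 * PI * (L * M ^ 2 * 1)).
  { apply J_bound; [cont|intros s; apply abs_mult_le; bound]. }
  assert (Ea : PI * al = - lam * (cos tau * Gc - sin tau * Gs)) by (unfold al; lra).
  assert (Eb : PI * be = - lam * (cos tau * Gs + sin tau * Gc)) by (unfold be; lra).
  split; apply Rmult_le_reg_l with PI; try exact hpi;
    rewrite <- (Rabs_pos_eq PI) at 1 by lra; rewrite <- Rabs_mult, ?Ea, ?Eb;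
    (eapply Rle_trans; [bound|]); nra.
Qed.

Let al_le := proj1 first_mode_residual.
Let be_le := proj2 first_mode_residual.

Let y1_le : forall s, Rabs (y1 s) <= 3 * M.
Proof.
  intros s. unfold y1.
  replace (f (y (s - tau))) with ((f (y (s - tau)) - y (s - tau)) + y (s - tau)) by ring.
  assert (HG : forall s, Rabs (f (y s) - y s) <= L * M ^ 2) by (intros; apply Hg, HM).
  eapply Rle_trans; [apply abs_mult_le; [bound|apply abs_plus_le; [apply HG|bound]]|].
  nra.
Qed.

Let h_le : forall s, Rabs (h s) <= 12 * (L * M ^ 2).
Proof.
  intros s. unfold h.
  assert (HG : forall s, Rabs (f (y s) - y s) <= L * M ^ 2) by (intros; apply Hg, HM).
  eapply Rle_trans; [bound|]. nra.
Qed.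

Let h1_le : forall s, Rabs (h1 s) <= 16 * (L * M ^ 2).
Proof.
  intros s. unfold h1.
  assert (HG : forall s, Rabs (f1 (y s) - 1) <= L * M) by (intros; apply Hg1, HM).
  eapply Rle_trans; [bound|]. nra.
Qed.

Let der_y : forall s, derivable_pt_lim y s (y1 s) := Hy.

Let der_r : forall s, derivable_pt_lim r s (r1 s).
Proof.
  intros s. unfold r. eapply dlim_eq; [dlim|].
  unfold r1, r, h, al, be, y1. rewrite sin_minus. ring.
Qed.

Let der_h : forall s, derivable_pt_lim h s (h1 s).
Proof.
  intros s. unfold h. eapply dlim_eq.
  - apply dlim_minus; [apply dlim_minus|]; [|dlim|dlim].
    apply dlim_scal, dlim_minus; [|apply dlim_shift, der_y].
    apply (dlim_comp f (fun u => y (u - tau))); [apply dlim_shift, der_y|apply Hf].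
  - unfold h1. ring.
Qed.

(** Differentiating the equation of [r] once more gives [r'' = lam^2 r(. - 2 tau) - lam h(. - tau) +
    h']. As [lam] is near 1 and [2 tau] near [PI], this is [r(. - PI)] plus a small forcing, and
    [half_period_shift_bound] applies. *)
Lemma harmonic_remainder (s : R) : Rabs (y s - b * sin s) <= 1000 * (L * M ^ 2).
Proof.
  pose proof PI_RGT_0 as hpi. pose proof continuity_sin as Cs. pose proof continuity_cos as Cc.
  assert (Hpr : per r) by (intros u; unfold r; now rewrite Hper, per_sin).
  destruct (per_abs_max r) as [s0 Hs0]; [exact Hpr|eapply dlim_continuity; exact der_r|].
  set (N := Rabs (r s0)) in *.
  assert (N0 : 0 <= N) by apply Rabs_pos.
  assert (r1_le : forall s, Rabs (r1 s) <= 2 * N + 12 * (L * M ^ 2)).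
  { intros u. unfold r1. eapply Rle_trans; [bound|]. nra. }
  assert (HN : forall s, Rabs (r s) <= 17 * (7 * eps * N + 41 * (L * M ^ 2))).
  { apply half_period_shift_bound with r1
      (fun u => (lam * lam - 1) * r (u - tau - tau) + (r (u - tau - tau) - r (u - PI))
                - lam * h (u - tau) + h1 u).
    - exact Hpr.
    - exact der_r.
    - intros u. unfold r1 at 1. eapply dlim_eq; [dlim|]. unfold r1. ring.
    - intros u.
      assert (S1 : Rabs (lam * lam - 1) <= 3 * eps).
      { replace (lam * lam - 1) with ((lam - 1) * (lam + 1)) by ring.
        eapply Rle_trans; [apply abs_mult_le; [exact Hlam|]|].
        - apply abs_plus_le; [exact lam_le|rewrite Rabs_R1; apply Rle_refl].
        - nra. }
      assert (S2 : Rabs (r (u - tau - tau) - r (u - PI)) <= (2 * N + 12 * (L * M ^ 2)) * (2 * eps)).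
      { eapply Rle_trans; [apply (mvt_bound_abs r r1 _ _ _ der_r r1_le)|].
        apply Rmult_le_compat_l; [lra|].
        replace (u - tau - tau - (u - PI)) with (- (2 * (tau - PI / 2))) by field.
        rewrite Rabs_Ropp, Rabs_mult, (Rabs_pos_eq 2) by lra. lra. }
      eapply Rle_trans; [bound|]. nra.
    - transitivity (J (fun s => y s * cos s - b * (sin s * cos s))).
      + apply J_ext. intros u. unfold r. ring.
      + rewrite J_minus, J_scal, Hcos, J_sin_cos by cont. ring.
    - transitivity (J (fun s => y s * sin s - b * sin s ^ 2)).
      + apply J_ext. intros u. unfold r. ring.
      + rewrite J_minus, J_scal, J_sin2 by cont. unfold b. field. lra. }
  (* At the maximum point the term [17 * 7 * eps * N] is at most [119 / 400 * N] and is absorbed on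
     the left, leaving [N <= 697 * 400 / 281 * (L * M ^ 2)]. *)
  eapply Rle_trans; [exact (Hs0 s)|]. specialize (HN s0). fold N in HN. nra.
Qed.
End Remainder.

(** * Expansion in the amplitude *)

Lemma lip_cos (u v : R) : Rabs (cos u - cos v) <= Rabs (u - v).
Proof.
  rewrite <- (Rmult_1_l (Rabs (u - v))).
  apply (mvt_bound_abs cos (fun s => - sin s)).
  - exact derivable_pt_lim_cos.
  - intros s. bound.
Qed.
Lemma lip_sin (u v : R) : Rabs (sin u - sin v) <= Rabs (u - v).
Proof.
  rewrite <- (Rmult_1_l (Rabs (u - v))).
  apply (mvt_bound_abs sin cos).
  - exact derivable_pt_lim_sin.
  - intros s. bound.
Qed.

(** Error constant of the expansion of the first mode when the remainder is at most [K * |b|^2]. It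
    involves neither [eps] nor the orbit, so that [eps] can be chosen small relative to it. [K1]
    controls the quadratic part, [K2] and [K3] the second mode, [K4] the pointwise cubic error. *)
Definition amplitude_constant (B C K : R) : R :=
  let K1 := 8 * (Rabs C + 1) + 3 * Rabs B * K in
  let K2 := 8 * K + 4 * Rabs B + 8 * K1 in
  let K3 := 48 * K1 + 21 * K2 in
  let K4 := 2 * Rabs B * K ^ 2 + 14 * Rabs C * K + 8 in
  8 * K4 + Rabs B * (16 * K1 + K3).

Section Amplitude.
Variables (f y : R -> R) (lam tau B C K eps b : R).
Hypothesis cont_f : continuity f.
Hypothesis Hper : per y.
Hypothesis Hy : forall s, derivable_pt_lim y s (- lam * f (y (s - tau))).
Hypothesis Hlam : Rabs (lam - 1) <= eps.
Hypothesis Htau : Rabs (tau - PI / 2) <= eps.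
Hypothesis Heps : eps <= / 400.
Hypothesis HK : 0 <= K.
Hypothesis Hb : Rabs b <= 2 * eps.
Hypothesis Hr : forall s, Rabs (y s - b * sin s) <= K * Rabs b ^ 2.
Hypothesis Hy2 : forall s, Rabs (y s) <= 2 * Rabs b.
Hypothesis Hf : forall s,
  Rabs (f (y s) - y s - B * y s ^ 2 - C * y s ^ 3) <= eps * Rabs (y s) ^ 3.

Let a := Rabs b.
Let K1 := 8 * (Rabs C + 1) + 3 * Rabs B * K.
Let K2 := 8 * K + 4 * Rabs B + 8 * K1.
Let K3 := 48 * K1 + 21 * K2.
Let K4 := 2 * Rabs B * K ^ 2 + 14 * Rabs C * K + 8.
Let K5 := 8 * K4 + Rabs B * (16 * K1 + K3).
Let G (W : R -> R) := J (fun s => (f (y s) - y s) * W s).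

Let cont_y : continuity y.
Proof. eapply dlim_continuity; exact Hy. Qed.
Let cs : continuity sin := continuity_sin.
Let cc : continuity cos := continuity_cos.
Let a0 : 0 <= a := Rabs_pos b.
Let eps0 : 0 <= eps.
Proof. pose proof (Rabs_pos (lam - 1)). lra. Qed.
Let a2 : b ^ 2 = a ^ 2 := eq_sym (pow2_abs b).
Let ba : Rabs b <= a := Rle_refl a.
Let B0 := Rabs_pos B.
Let C0 := Rabs_pos C.
Let aB : Rabs B <= Rabs B := Rle_refl _.
Let aC : Rabs C <= Rabs C := Rle_refl _.
Let pi0 := PI_RGT_0.
Let pi4 := PI_4.
Let K1_nonneg : 0 <= K1.
Proof. unfold K1. nra. Qed.
Let K2_nonneg : 0 <= K2.
Proof. unfold K2. nra. Qed.

Let y_abs3 : forall s, eps * Rabs (y s) ^ 3 <= 8 * eps * a ^ 3.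
Proof.
  intros s. replace (8 * eps * a ^ 3) with (eps * (2 * a) ^ 3) by ring.
  apply Rmult_le_compat_l; [exact eps0|]. apply pow_incr.
  split; [apply Rabs_pos|apply Hy2].
Qed.

(** To second order [f(y) - y] is [B b^2 sin^2]. The error consists of cubic terms and of
    [B (y - b sin) (y + b sin)], whose last two factors are of order [a^2] and [a]. *)
Lemma quadratic_part_bound (W : R -> R) :
  continuity W -> (forall s, Rabs (W s) <= 1) ->
  Rabs (G W - B * b ^ 2 * J (fun s => sin s ^ 2 * W s)) <= 8 * K1 * a ^ 3.
Proof.
  intros cW HW. unfold G. rewrite <- J_scal by cont.
  eapply Rle_trans; [apply J_near with (K := K1 * a ^ 3); [cont|cont|]|].
  - intros s.
    replace ((f (y s) - y s) * W s - B * b ^ 2 * (sin s ^ 2 * W s)) with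
      (((f (y s) - y s - B * y s ^ 2 - C * y s ^ 3) + C * (y s * y s * y s)
        + B * ((y s - b * sin s) * (y s + b * sin s))) * W s) by ring.
    eapply Rle_trans.
    + apply abs_mult_le; [|apply HW]. apply abs_plus_le; [apply abs_plus_le|].
      * eapply Rle_trans; [apply Hf|apply y_abs3].
      * apply abs_mult_le; [apply aC|]. bound.
      * apply abs_mult_le; [apply aB|]. apply abs_mult_le; [apply Hr|]. bound.
    + fold a. unfold K1. assert (0 <= a ^ 3) by now apply pow_le. nra.
  - assert (0 <= K1 * a ^ 3) by (apply Rmult_le_pos; [exact K1_nonneg|now apply pow_le]). nra.
Qed.

(** The zeroth mode says that [f o y] has mean zero, so [J y] is minus the integral of [f(y) - y],
    with main part [B b^2 J (sin^2)]. *)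
Lemma mean_estimate : Rabs (J y + B * PI * b ^ 2) <= 8 * K1 * a ^ 3.
Proof.
  assert (Hl : lam <> 0) by (apply Rabs_le_between in Hlam; lra).
  pose proof (fourier_mode_0 y f lam tau Hper cont_f Hy Hl) as E.
  assert (HG : G (fun _ => 1) = - J y).
  { unfold G. rewrite (J_ext _ (fun s => f (y s) - y s)) by (intros; ring).
    rewrite J_minus, E by cont. ring. }
  pose proof (quadratic_part_bound (fun _ => 1) (cont_const 1)) as Q.
  rewrite HG, <- (J_ext (fun s => sin s ^ 2) (fun s => sin s ^ 2 * 1)), J_sin2 in Q
    by (intros; ring).
  rewrite <- Rabs_Ropp.
  replace (- (J y + B * PI * b ^ 2)) with (- J y - B * b ^ 2 * PI) by ring.
  apply Q. intros s. rewrite Rabs_R1. lra.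
Qed.

(** At [lam = 1] and [tau = PI / 2] the second-mode equations read [2 sig = rho + Gc] and
    [- 2 rho = sig + Gs], hence [5 rho = - Gc - 2 Gs]. To leading order [Gc] is [- B PI b^2 / 2] and
    [Gs] vanishes. *)
Lemma second_mode_estimate :
  Rabs (5 * J (fun s => y s * cos (2 * s)) - B * PI * b ^ 2 / 2) <= K3 * eps * a ^ 2.
Proof.
  destruct (fourier_mode_2 y f lam tau Hper cont_f Hy) as [E1 E2].
  set (rho := J (fun s => y s * cos (2 * s))) in *.
  set (sig := J (fun s => y s * sin (2 * s))) in *.
  set (Gc := G (fun s => cos (2 * s))). set (Gs := G (fun s => sin (2 * s))).
  assert (Ec : J (fun s => f (y s) * cos (2 * s)) = rho + Gc).
  { unfold rho, Gc, G. rewrite <- J_plus by cont. apply J_ext. intros; ring. }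
  assert (Es : J (fun s => f (y s) * sin (2 * s)) = sig + Gs).
  { unfold sig, Gs, G. rewrite <- J_plus by cont. apply J_ext. intros; ring. }
  rewrite Ec, Es in E1, E2.
  assert (Qc : Rabs (Gc - B * b ^ 2 * (- PI / 2)) <= 8 * K1 * a ^ 3).
  { replace (- PI / 2) with (J (fun s => sin s ^ 2 * cos (2 * s))).
    - apply quadratic_part_bound; [cont|intros; bound].
    - rewrite (J_ext _ (fun s => sin s ^ 2 - 2 * sin s ^ 4)).
      + rewrite J_minus, J_scal, J_sin2, J_sin4 by cont. field.
      + intros s. rewrite cos_2a_sin. ring. }
  assert (Qs : Rabs Gs <= 8 * K1 * a ^ 3).
  { replace Gs with (Gs - B * b ^ 2 * J (fun s => sin s ^ 2 * sin (2 * s))).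
    - apply quadratic_part_bound; [cont|intros; bound].
    - rewrite (J_ext _ (fun s => 2 * (sin s ^ 3 * cos s))).
      + rewrite J_scal, J_sin3_cos by cont. ring.
      + intros s. rewrite sin_2a. ring. }
  (* [sin] is orthogonal to the second harmonics, so only the remainder [y - b sin] contributes to
     [rho] and [sig]. *)
  assert (Hrho : Rabs rho <= 8 * K * a ^ 2).
  { replace rho with (J (fun s => (y s - b * sin s) * cos (2 * s))).
    - eapply Rle_trans; [apply J_bound; [cont|intros; apply abs_mult_le; [apply Hr|bound]]|].
      fold a. assert (0 <= K * a ^ 2) by (apply Rmult_le_pos; [exact HK|now apply pow_le]). nra.
    - rewrite (J_ext _ (fun s => y s * cos (2 * s) - b * (sin s - 2 * sin s ^ 3))).
      + rewrite J_minus, J_scal, J_minus, J_scal, J_sin, J_sin3 by cont. fold rho. ring.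
      + intros s. rewrite (cos_2a_sin s). ring. }
  assert (Hsig : Rabs sig <= 8 * K * a ^ 2).
  { replace sig with (J (fun s => (y s - b * sin s) * sin (2 * s))).
    - eapply Rle_trans; [apply J_bound; [cont|intros; apply abs_mult_le; [apply Hr|bound]]|].
      fold a. assert (0 <= K * a ^ 2) by (apply Rmult_le_pos; [exact HK|now apply pow_le]). nra.
    - rewrite (J_ext _ (fun s => y s * sin (2 * s) - b * (2 * (sin s ^ 2 * cos s)))).
      + rewrite J_minus, !J_scal, J_sin2_cos by cont. fold sig. ring.
      + intros s. rewrite (sin_2a s). ring. }
  assert (a3 : a ^ 3 <= 2 * eps * a ^ 2).
  { replace (a ^ 3) with (a * a ^ 2) by ring.
    apply Rmult_le_compat_r; [now apply pow_le|exact Hb]. }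
  assert (a2_nonneg : 0 <= a ^ 2) by now apply pow_le.
  assert (a3' : a ^ 3 <= a ^ 2) by nra.
  assert (HX : Rabs (rho + Gc) <= K2 * a ^ 2).
  { replace (rho + Gc) with (rho + ((Gc - B * b ^ 2 * (- PI / 2)) + B * (- a ^ 2 * (PI / 2))))
      by (rewrite a2; field).
    eapply Rle_trans.
    - apply abs_plus_le; [exact Hrho|]. apply abs_plus_le; [exact Qc|].
      apply abs_mult_le; [exact aB|]. apply Rle_refl.
    - replace (Rabs (- a ^ 2 * (PI / 2))) with (a ^ 2 * (PI / 2))
        by (rewrite Rabs_mult, Rabs_Ropp, !Rabs_pos_eq; lra).
      unfold K2. assert (K1 * a ^ 3 <= K1 * a ^ 2) by (now apply Rmult_le_compat_l).
      assert (Rabs B * a ^ 2 * (PI / 2) <= Rabs B * a ^ 2 * 2).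
      { apply Rmult_le_compat_l; [apply Rmult_le_pos; assumption|lra]. }
      nra. }
  assert (HY : Rabs (sig + Gs) <= K2 * a ^ 2).
  { eapply Rle_trans; [apply abs_plus_le; [exact Hsig|exact Qs]|].
    unfold K2. assert (K1 * a ^ 3 <= K1 * a ^ 2) by (now apply Rmult_le_compat_l). nra. }
  assert (Hct : Rabs (cos (2 * tau) + 1) <= 2 * eps).
  { replace (cos (2 * tau) + 1) with (cos (2 * tau) - cos PI) by (rewrite cos_PI; ring).
    eapply Rle_trans; [apply lip_cos|].
    replace (2 * tau - PI) with (2 * (tau - PI / 2)) by field.
    rewrite Rabs_mult, (Rabs_pos_eq 2); lra. }
  assert (Hst : Rabs (sin (2 * tau)) <= 2 * eps).
  { replace (sin (2 * tau)) with (sin (2 * tau) - sin PI) by (rewrite sin_PI; ring).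
    eapply Rle_trans; [apply lip_sin|].
    replace (2 * tau - PI) with (2 * (tau - PI / 2)) by field.
    rewrite Rabs_mult, (Rabs_pos_eq 2); lra. }
  assert (lam_le : Rabs lam <= 2) by (apply Rabs_le_between in Hlam; apply Rabs_le; lra).
  assert (Hlc : Rabs ((lam - 1) * cos (2 * tau) + (cos (2 * tau) + 1)) <= 3 * eps).
  { eapply Rle_trans; [bound|]. lra. }
  assert (Hls : Rabs (lam * sin (2 * tau)) <= 4 * eps).
  { eapply Rle_trans; [apply abs_mult_le; [exact lam_le|exact Hst]|]. lra. }
  assert (H1 : Rabs (2 * sig - (rho + Gc)) <= 7 * eps * (K2 * a ^ 2)).
  { replace (2 * sig - (rho + Gc)) with
      (lam * sin (2 * tau) * (sig + Gs)
       - ((lam - 1) * cos (2 * tau) + (cos (2 * tau) + 1)) * (rho + Gc)) by lra.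
    eapply Rle_trans; [apply abs_minus_le; (apply abs_mult_le; [eassumption|eassumption])|]. lra. }
  assert (H2 : Rabs (- 2 * rho - (sig + Gs)) <= 7 * eps * (K2 * a ^ 2)).
  { replace (- 2 * rho - (sig + Gs)) with
      (- (lam * sin (2 * tau) * (rho + Gc))
       - ((lam - 1) * cos (2 * tau) + (cos (2 * tau) + 1)) * (sig + Gs)) by lra.
    eapply Rle_trans.
    - apply abs_minus_le; [apply abs_opp_le|]; (apply abs_mult_le; [eassumption|eassumption]).
    - lra. }
  assert (K1 * a ^ 3 <= K1 * (2 * eps * a ^ 2)) by (now apply Rmult_le_compat_l).
  apply Rabs_le_between in H1, H2, Qc, Qs.
  (* Adding [H1] and twice [H2] eliminates [sig]; the three multiples of [7 * K2] give 21, and [Qc]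
     with twice [Qs] gives [3 * 8 * 2 = 48] through [a ^ 3 <= 2 * eps * a ^ 2]. *)
  apply Rabs_le. unfold K3. lra.
Qed.

(** Up to the square of the remainder, [y^2] is [2 b y sin - b^2 sin^2]. Against [sin], the first
    term becomes [b (J y - rho)] since [2 sin^2 = 1 - cos 2s]. With [J y ~ - B PI b^2] and
    [rho ~ B PI b^2 / 10] this is [- 11/10 B PI b^3]; together with [3/4 PI C b^3] from the cubic
    term it produces the ratio [22/15]. *)
Lemma first_mode_estimate :
  Rabs (G sin - 3 / 4 * PI * (C - 22 / 15 * B ^ 2) * b ^ 3) <= K5 * eps * a ^ 3.
Proof.
  set (rho := J (fun s => y s * cos (2 * s))).
  assert (a3 : a ^ 3 <= 2 * eps * a ^ 2).
  { replace (a ^ 3) with (a * a ^ 2) by ring.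
    apply Rmult_le_compat_r; [now apply pow_le|exact Hb]. }
  assert (a4 : a ^ 4 <= 2 * eps * a ^ 3).
  { replace (a ^ 4) with (a * a ^ 3) by ring.
    apply Rmult_le_compat_r; [now apply pow_le|exact Hb]. }
  assert (a3_nonneg : 0 <= a ^ 3) by now apply pow_le.
  assert (EJ : J (fun s => B * (2 * b * (sin s ^ 2 * y s) - b ^ 2 * sin s ^ 3)
                              + C * b ^ 3 * sin s ^ 4)
               = B * b * (J y - rho) + C * b ^ 3 * (3 * PI / 4)).
  { rewrite (J_ext _ (fun s => B * (b * (y s - y s * cos (2 * s)) - b ^ 2 * sin s ^ 3)
                               + C * b ^ 3 * sin s ^ 4)).
    - rewrite J_plus, !J_scal, J_minus, !J_scal, J_minus, J_sin3, J_sin4 by cont.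
      fold rho. ring.
    - intros s. rewrite cos_2a_sin. field. }
  assert (Q : Rabs (G sin - (B * b * (J y - rho) + C * b ^ 3 * (3 * PI / 4)))
              <= 8 * K4 * eps * a ^ 3).
  { rewrite <- EJ. unfold G.
    eapply Rle_trans; [apply J_near with (K := K4 * eps * a ^ 3); [cont|cont|]|].
    - intros s.
      replace ((f (y s) - y s) * sin s -
         (B * (2 * b * (sin s ^ 2 * y s) - b ^ 2 * sin s ^ 3) + C * b ^ 3 * sin s ^ 4))
      with (((f (y s) - y s - B * y s ^ 2 - C * y s ^ 3)
             + B * ((y s - b * sin s) * (y s - b * sin s))
             + C * ((y s - b * sin s) *
                    (y s * y s + y s * (b * sin s) + b * sin s * (b * sin s)))) * sin s) by ring.
      eapply Rle_trans.
      + apply abs_mult_le; [|bound]. apply abs_plus_le; [apply abs_plus_le|].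
        * eapply Rle_trans; [apply Hf|apply y_abs3].
        * apply abs_mult_le; [exact aB|]. apply abs_mult_le; apply Hr.
        * apply abs_mult_le; [exact aC|]. apply abs_mult_le; [apply Hr|bound].
      + fold a. unfold K4.
        assert (Rabs B * K ^ 2 * a ^ 4 <= Rabs B * K ^ 2 * (2 * eps * a ^ 3)).
        { apply Rmult_le_compat_l; [apply Rmult_le_pos; [exact B0|now apply pow_le]|exact a4]. }
        assert (Rabs C * K * a ^ 4 <= Rabs C * K * (2 * eps * a ^ 3)).
        { apply Rmult_le_compat_l; [apply Rmult_le_pos; assumption|exact a4]. }
        lra.
    - assert (0 <= K4).
      { unfold K4. assert (0 <= K ^ 2) by now apply pow_le. nra. }
      assert (0 <= K4 * eps * a ^ 3) by (apply Rmult_le_pos; [now apply Rmult_le_pos|assumption]). nra. }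
  pose proof mean_estimate as Q0. pose proof second_mode_estimate as Q2. fold rho in Q2.
  assert (Q' : Rabs (J y - rho + 11 / 10 * B * PI * b ^ 2) <= (16 * K1 + K3) * eps * a ^ 2).
  { assert (K1 * a ^ 3 <= K1 * (2 * eps * a ^ 2)) by (now apply Rmult_le_compat_l).
    apply Rabs_le_between in Q0, Q2.
    assert (0 <= K3 * eps * a ^ 2) by lra.
    apply Rabs_le. lra. }
  replace (G sin - 3 / 4 * PI * (C - 22 / 15 * B ^ 2) * b ^ 3) with
    ((G sin - (B * b * (J y - rho) + C * b ^ 3 * (3 * PI / 4)))
     + B * (b * (J y - rho + 11 / 10 * B * PI * b ^ 2))) by field.
  eapply Rle_trans.
  - apply abs_plus_le; [exact Q|]. apply abs_mult_le; [exact aB|].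
    apply abs_mult_le; [exact ba|exact Q'].
  - unfold K5. apply Req_le. ring.
Qed.

Hypothesis Hcos : J (fun s => y s * cos s) = 0.
Hypothesis Hsin : J (fun s => y s * sin s) = PI * b.

(* The first Fourier coefficients of [y'] and of [lam f(y(. - tau))] have equal moduli, and the
   modulus of the latter does not depend on [tau]. *)
Lemma lam_le_1 :
  b <> 0 -> amplitude_constant B C K * eps <= 3 / 4 * PI * (C - 22 / 15 * B ^ 2) -> lam <= 1.
Proof.
  intros b0 Hsmall. change (amplitude_constant B C K) with K5 in Hsmall.
  destruct (fourier_mode_1 y f lam tau Hper cont_f Hy) as [E1 E2].
  rewrite Hcos in E2. rewrite Hsin in E1.
  set (Fc := J (fun s => f (y s) * cos s)) in *.
  assert (Es : J (fun s => f (y s) * sin s) = PI * b + G sin).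
  { rewrite <- Hsin. unfold G. rewrite <- J_plus by cont. apply J_ext. intros; ring. }
  rewrite Es in E1, E2. set (Gs := G sin) in *.
  (* Multiplying by [b] makes the main term [c * b ^ 4] independent of the sign of [b]; by [Hsmall]
     it dominates the error. *)
  assert (Hpos : 0 <= b * Gs).
  { pose proof first_mode_estimate as Q. fold Gs in Q.
    set (c := 3 / 4 * PI * (C - 22 / 15 * B ^ 2)) in *.
    assert (Rabs (b * (Gs - c * b ^ 3)) <= a * (K5 * eps * a ^ 3)) by (now apply abs_mult_le).
    apply Rabs_le_between in H.
    assert (c * b ^ 4 = c * a ^ 4)
      by (replace (b ^ 4) with ((b ^ 2) ^ 2) by ring; rewrite a2; ring).
    assert (0 <= (c - K5 * eps) * a ^ 4).
    { apply Rmult_le_pos; [lra|now apply pow_le]. }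
    lra. }
  assert (E : (PI * b) ^ 2 = lam ^ 2 * ((PI * b + Gs) ^ 2 + Fc ^ 2)).
  { pose proof (sin2_cos2 tau) as T. unfold Rsqr in T.
    transitivity (lam ^ 2 * ((sin tau * sin tau + cos tau * cos tau) * ((PI * b + Gs) ^ 2 + Fc ^ 2))).
    - transitivity ((PI * b) ^ 2 + (- 0) ^ 2); [ring|]. rewrite E1 at 1. rewrite E2. ring.
    - rewrite T. ring. }
  assert (P0 : 0 < (PI * b) ^ 2).
  { apply pow2_gt_0. apply Rmult_integral_contrapositive. split; [lra|exact b0]. }
  (* The cross term [2 * PI * b * Gs] is nonnegative by [Hpos]. *)
  assert (P1 : (PI * b) ^ 2 <= (PI * b + Gs) ^ 2 + Fc ^ 2).
  { pose proof (pow2_ge_0 Gs). pose proof (pow2_ge_0 Fc). nra. }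
  destruct (Rle_lt_dec lam 1) as [h|h]; [exact h|exfalso].
  assert (1 < lam ^ 2) by nra. nra.
Qed.
End Amplitude.

(** * Small periodic orbits *)

(** The mean value inequality between 0 and [s] gains one power and keeps the constant [c]. *)
Lemma power_growth (w w' : R -> R) (n : nat) (c d : R) :
  0 <= c -> (forall s, derivable_pt_lim w s (w' s)) -> w 0 = 0 ->
  (forall s, Rabs s < d -> Rabs (w' s) <= c * Rabs s ^ n) ->
  forall s, Rabs s < d -> Rabs (w s) <= c * Rabs s ^ S n.
Proof.
  intros hc Hd H0 Hb s hs.
  assert (Hi : forall u, Rabs u <= Rabs s -> Rabs (w' u) <= c * Rabs s ^ n).
  { intros u hu. eapply Rle_trans; [apply Hb; lra|].
    apply Rmult_le_compat_l; [exact hc|]. apply pow_incr. split; [apply Rabs_pos|exact hu]. }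
  replace (c * Rabs s ^ S n) with (c * Rabs s ^ n * Rabs s) by (simpl; ring).
  destruct (Rle_dec 0 s) as [h|h].
  - replace (w s) with (w s - w 0) by lra.
    replace (Rabs s) with (s - 0) at 2 by (rewrite Rabs_pos_eq; lra).
    apply mvt_bound with w'; auto. intros u hu. apply Hi. rewrite !Rabs_pos_eq; lra.
  - rewrite <- (Rabs_Ropp (w s)). replace (- w s) with (w 0 - w s) by lra.
    replace (Rabs s) with (0 - s) at 2 by (rewrite Rabs_left; lra).
    apply mvt_bound with w'; auto; [lra|]. intros u hu. apply Hi.
    rewrite <- (Rabs_Ropp u), <- (Rabs_Ropp s), !Rabs_pos_eq; lra.
Qed.

(** Differentiability of [f2] at 0 gives its first-order expansion, and two applications of
    [power_growth] lift it to [f1] and then to [f]. The expansion of [f1] serves to bound the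
    derivative of the forcing [h]. *)
Lemma taylor_expansion (f f1 f2 f3 : R -> R) (eps : R) :
  C3_with f f1 f2 f3 -> f 0 = 0 -> f1 0 = 1 -> 0 < eps ->
  exists d, 0 < d /\ forall x, Rabs x < d ->
    Rabs (f1 x - 1 - 2 * (f2 0 / 2) * x - 3 * (f3 0 / 6) * x ^ 2) <= eps * Rabs x ^ 2 /\
    Rabs (f x - x - (f2 0 / 2) * x ^ 2 - (f3 0 / 6) * x ^ 3) <= eps * Rabs x ^ 3.
Proof.
  intros [Hf [Hf1 [Hf2 _]]] H0 H1 he.
  destruct (Hf2 0 eps he) as [[d hd] Hd]. simpl in Hd. exists d. split; [exact hd|].
  assert (D2 : forall x, Rabs x < d -> Rabs (f2 x - f2 0 - f3 0 * x) <= eps * Rabs x ^ 1).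
  { intros x hx. destruct (Req_dec x 0) as [->|hn].
    - replace (f2 0 - f2 0 - f3 0 * 0) with 0 by ring. rewrite Rabs_R0. lra.
    - specialize (Hd x hn hx). rewrite Rplus_0_l in Hd.
      replace (f2 x - f2 0 - f3 0 * x) with (((f2 x - f2 0) / x - f3 0) * x) by (field; exact hn).
      rewrite Rabs_mult, pow_1. apply Rmult_le_compat_r; [apply Rabs_pos|lra]. }
  assert (P : forall (c : R) (n : nat) (x : R),
            derivable_pt_lim (fun u => c * u ^ n) x (c * (INR n * x ^ pred n))).
  { intros c n x. apply dlim_scal, derivable_pt_lim_pow. }
  assert (D1 : forall x, Rabs x < d ->
            Rabs (f1 x - 1 - 2 * (f2 0 / 2) * x - 3 * (f3 0 / 6) * x ^ 2) <= eps * Rabs x ^ 2).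
  { apply (power_growth _ (fun x => f2 x - f2 0 - f3 0 * x)); [lra| |rewrite H1; ring|exact D2].
    intros x.
    apply dlim_ext with (fun u => f1 u - 1 - 2 * (f2 0 / 2) * u ^ 1 - 3 * (f3 0 / 6) * u ^ 2).
    { intros u. ring. }
    eapply dlim_eq.
    - apply dlim_minus; [apply dlim_minus; [apply dlim_minus; [apply Hf1|apply derivable_pt_lim_const]|]|];
        apply P.
    - simpl. field. }
  intros x hx. split; [now apply D1|]. revert x hx.
  apply (power_growth _
    (fun x => f1 x - 1 - 2 * (f2 0 / 2) * x - 3 * (f3 0 / 6) * x ^ 2));
    [lra| |rewrite H0; ring|exact D1].
  intros x.
  apply dlim_ext with (fun u => f u - 1 * u ^ 1 - (f2 0 / 2) * u ^ 2 - (f3 0 / 6) * u ^ 3).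
  { intros u. ring. }
  eapply dlim_eq.
  - apply dlim_minus; [apply dlim_minus; [apply dlim_minus; [apply Hf|]|]|]; apply P.
  - simpl. field.
Qed.

(** Translation rotates the vector of first Fourier coefficients, so some angle makes its cosine
    component vanish. *)
Lemma phase_choice (y : R -> R) :
  per y -> continuity y -> exists phi, J (fun s => y (s - phi) * cos s) = 0.
Proof.
  intros Hp Hc. pose proof continuity_sin as Cs. pose proof continuity_cos as Cc.
  assert (E : forall phi, J (fun s => y (s - phi) * cos s) =
            cos phi * J (fun s => y s * cos s) - sin phi * J (fun s => y s * sin s)).
  { intros phi. pose (Q := fun s => cos phi * (y s * cos s) - sin phi * (y s * sin s)).
    rewrite (J_ext _ (fun s => Q (s - phi))).
    - rewrite (J_shift Q); unfold Q.
      + rewrite J_minus, !J_scal by cont. reflexivity.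
      + intros s. now rewrite Hp, per_cos, per_sin.
      + cont.
    - intros s. unfold Q. replace (cos s) with (cos (s - phi + phi)) by (f_equal; ring).
      rewrite cos_plus. ring. }
  set (c := J (fun s => y s * cos s)) in *. set (d := J (fun s => y s * sin s)) in *.
  destruct (Req_dec d 0) as [h|h].
  - exists (PI / 2). rewrite E, cos_PI2, h. ring.
  - exists (atan (c / d)). rewrite E.
    assert (hc : 0 < cos (atan (c / d))) by (pose proof (atan_bound (c / d)); apply cos_gt_0; lra).
    pose proof (tan_atan (c / d)) as T. unfold tan in T.
    replace (sin (atan (c / d))) with (sin (atan (c / d)) / cos (atan (c / d)) * cos (atan (c / d)))
      by (field; lra).
    rewrite T. field. exact h.
Qed.

(** The claim in rescaled time, with a threshold [e] depending only on [f]. The orbit is translated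
    to remove its cosine coefficient, and its size [M] is compared with [b] before [lam_le_1] is
    applied. *)
Lemma small_orbit_frequency (f f1 f2 f3 : R -> R) :
  C3_with f f1 f2 f3 -> f 0 = 0 -> f1 0 = 1 ->
  f3 0 / 6 > 22 / 15 * (f2 0 / 2) ^ 2 ->
  exists e, 0 < e /\ forall (lam tau : R) (y : R -> R),
    Rabs (lam - 1) <= e -> Rabs (tau - PI / 2) <= e ->
    per y -> (forall s, derivable_pt_lim y s (- lam * f (y (s - tau)))) ->
    (forall s, Rabs (y s) <= e) -> (exists s, y s <> 0) ->
    lam <= 1.
Proof.
  intros HC H0 H1 Hsub. pose proof PI_RGT_0 as hpi.
  pose proof (fun eps => taylor_expansion f f1 f2 f3 eps HC H0 H1) as Htaylor.
  destruct HC as [Hf _].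
  set (B := f2 0 / 2) in *. set (C := f3 0 / 6) in *. clearbody B C.
  set (L := 2 * Rabs B + 3 * Rabs C + 1).
  pose proof (Rabs_pos B) as B0. pose proof (Rabs_pos C) as C0.
  assert (L1 : 1 <= L) by (unfold L; lra).
  (* The remainder bound [1000 * L * M ^ 2] together with [M <= 2 * Rabs b] gives
     [4000 * L * Rabs b ^ 2]. *)
  set (A := amplitude_constant B C (4000 * L)).
  set (c := 3 / 4 * PI * (C - 22 / 15 * B ^ 2)).
  assert (c0 : 0 < c) by (apply Rmult_lt_0_compat; lra).
  (* The first bound makes the remainder at most [M / 2], the second keeps the error [A * eps] below
     the main coefficient [c]. *)
  set (eps := Rmin (/ (2000 * L)) (c / (Rabs A + 1))).
  pose proof (Rabs_pos A) as A0.
  assert (e0 : 0 < eps).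
  { apply Rmin_glb_lt; [apply Rinv_0_lt_compat; lra|apply Rdiv_lt_0_compat; lra]. }
  assert (eL : eps * (2000 * L) <= 1).
  { rewrite <- (Rinv_l (2000 * L)) by lra. apply Rmult_le_compat_r; [lra|apply Rmin_l]. }
  assert (eA : A * eps <= c).
  { apply Rle_trans with ((Rabs A + 1) * eps).
    - apply Rmult_le_compat_r; [lra|]. pose proof (Rle_abs A). lra.
    - replace c with ((Rabs A + 1) * (c / (Rabs A + 1))) by (field; lra).
      apply Rmult_le_compat_l; [lra|apply Rmin_r]. }
  assert (e400 : eps <= / 400) by nra.
  destruct (Htaylor eps e0) as [d [d0 Hd]]. clear Htaylor.
  exists (Rmin eps (d / 2)). split; [apply Rmin_glb_lt; lra|].
  intros lam tau y' Hlam Htau Hper' Hy' Hsmall [s1 Hs1].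
  pose proof (Rmin_l eps (d / 2)) as Hm1. pose proof (Rmin_r eps (d / 2)) as Hm2.
  assert (cont_f : continuity f) by (eapply dlim_continuity; exact Hf).
  destruct (phase_choice y' Hper') as [phi Hphi]; [eapply dlim_continuity; exact Hy'|].
  set (y := fun s => y' (s - phi)) in *.
  assert (Hper : per y) by (apply (per_shift y' phi Hper')).
  assert (Hy : forall s, derivable_pt_lim y s (- lam * f (y (s - tau)))).
  { intros s. unfold y. replace (s - tau - phi) with (s - phi - tau) by ring.
    apply dlim_shift, Hy'. }
  destruct (per_abs_max y Hper) as [s0 Hs0]; [eapply dlim_continuity; exact Hy|].
  set (M := Rabs (y s0)) in *.
  assert (hM : M <= eps /\ M < d).
  { pose proof (Hsmall (s0 - phi)) as h. change (Rabs (y' (s0 - phi))) with M in h. lra. }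
  assert (M0 : 0 < M).
  { pose proof (Hs0 (s1 + phi)) as h. unfold y in h at 1.
    replace (s1 + phi - phi) with s1 in h by ring. pose proof (Rabs_pos_lt _ Hs1). lra. }
  assert (Hg : forall x, Rabs x <= M -> Rabs (f x - x) <= L * M ^ 2).
  { intros x hx. destruct (Hd x) as [_ h]; [lra|].
    replace (f x - x) with (f x - x - B * x ^ 2 - C * x ^ 3 + (B * (x * x) + C * (x * x * x))) by ring.
    eapply Rle_trans.
    - apply abs_plus_le; [exact h|]. apply abs_plus_le; bound.
    - assert (Rabs x ^ 3 <= M ^ 3) by (apply pow_incr; split; [apply Rabs_pos|exact hx]).
      assert (M ^ 3 <= M ^ 2) by nra.
      assert (eps * Rabs x ^ 3 <= 1 * M ^ 2).
      { apply Rmult_le_compat; try lra. apply pow_le, Rabs_pos. }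
      assert (Rabs C * M ^ 3 <= Rabs C * M ^ 2) by (now apply Rmult_le_compat_l).
      assert (0 <= Rabs B * M ^ 2) by (apply Rmult_le_pos; [exact B0|apply pow_le; lra]).
      assert (0 <= Rabs C * M ^ 2) by (apply Rmult_le_pos; [exact C0|apply pow_le; lra]).
      unfold L. lra. }
  assert (Hg1 : forall x, Rabs x <= M -> Rabs (f1 x - 1) <= L * M).
  { intros x hx. destruct (Hd x) as [h _]; [lra|].
    replace (f1 x - 1) with
      (f1 x - 1 - 2 * B * x - 3 * C * x ^ 2 + (2 * (B * x) + 3 * (C * (x * x)))) by ring.
    assert (a2 : Rabs 2 <= 2) by (rewrite Rabs_pos_eq; lra).
    assert (a3 : Rabs 3 <= 3) by (rewrite Rabs_pos_eq; lra).
    eapply Rle_trans.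
    - apply abs_plus_le; [exact h|]. apply abs_plus_le; (apply abs_mult_le; [eassumption|bound]).
    - assert (Rabs x ^ 2 <= M ^ 2) by (apply pow_incr; split; [apply Rabs_pos|exact hx]).
      assert (M ^ 2 <= M) by nra.
      assert (eps * Rabs x ^ 2 <= 1 * M).
      { apply Rmult_le_compat; try lra. apply pow_le, Rabs_pos. }
      assert (Rabs C * M ^ 2 <= Rabs C * M) by (now apply Rmult_le_compat_l).
      unfold L. lra. }
  assert (Hlam' : Rabs (lam - 1) <= eps) by lra.
  assert (Htau' : Rabs (tau - PI / 2) <= eps) by lra.
  set (b := J (fun s => y s * sin s) / PI).
  assert (Hrem : forall s, Rabs (y s - b * sin s) <= 1000 * (L * M ^ 2)).
  { apply (harmonic_remainder f f1 y lam tau L M eps); try assumption; nra. }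
  assert (LM2 : 1000 * (L * M ^ 2) <= M / 2) by nra.
  (* At the maximum point of [|y|] the remainder accounts for at most half of [M], so the harmonic
     [b sin] accounts for the rest; in particular [b] is nonzero. *)
  assert (hMb : M <= 2 * Rabs b).
  { assert (h : M <= 1000 * (L * M ^ 2) + Rabs b * 1).
    { unfold M at 1. replace (y s0) with (y s0 - b * sin s0 + b * sin s0) by ring.
      apply abs_plus_le; [apply Hrem|]. apply abs_mult_le; [apply Rle_refl|apply abs_sin_le]. }
    lra. }
  assert (hbM : Rabs b <= 2 * M).
  { unfold b. unfold Rdiv. rewrite Rabs_mult, Rabs_inv, (Rabs_pos_eq PI) by lra.
    apply Rmult_le_reg_r with PI; [exact hpi|].
    rewrite Rmult_assoc, Rinv_l, Rmult_1_r by lra.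
    eapply Rle_trans; [apply J_bound with (K := M * 1)|lra].
    - assert (Cy : continuity y) by (eapply dlim_continuity; exact Hy).
      pose proof continuity_sin. cont.
    - intros s. apply abs_mult_le; [apply Hs0|apply abs_sin_le]. }
  apply (lam_le_1 f y lam tau B C (4000 * L) eps b); try assumption.
  - lra.
  - lra.
  - intros s. eapply Rle_trans; [apply Hrem|].
    assert (M ^ 2 <= (2 * Rabs b) ^ 2) by (apply pow_incr; lra). nra.
  - intros s. eapply Rle_trans; [apply Hs0|exact hMb].
  - intros s. apply (Hd (y s)). pose proof (Hs0 s). lra.
  - unfold b. field. lra.
  - intros h. rewrite h, Rabs_R0 in hMb. lra.
Qed.

(** * Rescaling the Hopf branch to period [2 * PI] *)

Theorem theorem3 (f f1 f2 f3 : R -> R) (k : nat) (etak : R)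
    (p : R -> R -> R) (T : R -> R) :
  C3_with f f1 f2 f3 ->
  f 0 = 0 -> f1 0 = 1 ->
  (forall m : Z, f3 0 / 6 > Hk (IZR m) * (f2 0 / 2) ^ 2) ->
  subcritical_hopf_branch f k etak p T ->
  exists eps, 0 < eps /\
    forall eta, 0 < eta < etak -> eta < eps ->
      T eta <= 4 / (4 * INR k + 1 - 2 * eta / PI).
Proof.
  intros HC H0 H1 Hsub [_ [Hsol [Hamp Hper]]].
  pose proof PI_RGT_0 as hpi. pose proof (pos_INR k) as hk.
  assert (Hstrict : f3 0 / 6 > 22 / 15 * (f2 0 / 2) ^ 2).
  { (* H(-1) = 22/15 + 8/(45 pi) *)
    specialize (Hsub (-1)%Z). unfold Hk in Hsub.
    replace ((22 * (4 * -1 + 1) * PI - 8) / (15 * (4 * -1 + 1) * PI))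
      with (22 / 15 + 8 / (45 * PI)) in Hsub by (field; lra).
    assert (0 < 8 / (45 * PI)) by (apply Rdiv_lt_0_compat; lra).
    pose proof (pow2_ge_0 (f2 0 / 2)). nra. }
  destruct (small_orbit_frequency f f1 f2 f3 HC H0 H1 Hstrict) as [e [he Hkey]].
  set (T0 := 4 / (4 * INR k + 1)) in *. set (m := mu (INR k)) in *.
  assert (hT0 : 0 < T0) by (apply Rdiv_lt_0_compat; lra).
  assert (hm : m * T0 = 2 * PI) by (unfold m, T0, mu; field; lra).
  assert (hm0 : 0 < m) by (unfold m, mu; nra).
  (* Allowed deviation of the period from [T0]: the three bounds keep the period above [T0 / 2],
     [lam] near 1 and [tau] near [PI / 2]. *)
  set (q := Rmin (T0 / 2) (Rmin (e / m) (e * T0 / (2 * m)))).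
  assert (hq : 0 < q).
  { repeat apply Rmin_glb_lt; apply Rdiv_lt_0_compat; nra. }
  assert (hq1 : q <= T0 / 2) by apply Rmin_l.
  assert (hq2 : m * q <= e).
  { replace e with (m * (e / m)) by (field; lra). apply Rmult_le_compat_l; [lra|].
    eapply Rle_trans; [apply Rmin_r|apply Rmin_l]. }
  assert (hq3 : m * q <= e * (T0 / 2)).
  { replace (e * (T0 / 2)) with (m * (e * T0 / (2 * m))) by (field; lra).
    apply Rmult_le_compat_l; [lra|].
    eapply Rle_trans; [apply Rmin_r|apply Rmin_r]. }
  destruct (Hamp e he) as [d1 [hd1 Hd1]]. destruct (Hper q hq) as [d2 [hd2 Hd2]].
  clear Hamp Hper.
  (* The first bound keeps the parameter [m - eta] positive, the second makes the contribution of
     [eta] to [lam - 1] small. *)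
  set (d3 := Rmin m (e / (2 * T0))).
  assert (hd3 : 0 < d3) by (apply Rmin_glb_lt; [lra|apply Rdiv_lt_0_compat; lra]).
  exists (Rmin d1 (Rmin d2 d3)).
  split; [apply Rmin_glb_lt; [exact hd1|now apply Rmin_glb_lt]|].
  intros eta Heta Hlt.
  assert (h1 : eta < d1) by (eapply Rlt_le_trans; [exact Hlt|apply Rmin_l]).
  assert (h2 : eta < d2).
  { eapply Rlt_le_trans; [exact Hlt|]. eapply Rle_trans; [apply Rmin_r|apply Rmin_l]. }
  assert (h3 : eta < d3).
  { eapply Rlt_le_trans; [exact Hlt|]. eapply Rle_trans; [apply Rmin_r|apply Rmin_r]. }
  assert (h4 : eta < m) by (eapply Rlt_le_trans; [exact h3|apply Rmin_l]).
  assert (h5 : eta * (2 * T0) < e).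
  { replace e with (e / (2 * T0) * (2 * T0)) by (field; lra).
    apply Rmult_lt_compat_r; [lra|]. eapply Rlt_le_trans; [exact h3|apply Rmin_r]. }
  destruct (Hsol eta Heta) as [Hx [Hne [hT [HT _]]]].
  specialize (Hd1 eta Heta h1). specialize (Hd2 eta Heta h2).
  set (x := p eta) in *. set (t := T eta) in *.
  apply Rabs_lt_between in Hd2.
  assert (Hlam : (m - eta) * (t / (2 * PI)) <= 1).
  { apply (Hkey _ (2 * PI / t - INR k * (2 * PI)) (fun s => x (s * (t / (2 * PI))))).
    - pose proof PI2_1.
      replace ((m - eta) * (t / (2 * PI)) - 1) with ((m * (t - T0) - eta * t) / (2 * PI))
        by (unfold Rminus; rewrite Rmult_plus_distr_l, <- Ropp_mult_distr_r, hm; field; lra).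
      assert (Rabs (m * (t - T0) - eta * t) <= e * (2 * PI)).
      { apply Rabs_le. split; nra. }
      unfold Rdiv. rewrite Rabs_mult, Rabs_inv, (Rabs_pos_eq (2 * PI)) by lra.
      apply Rmult_le_reg_r with (2 * PI); [lra|].
      rewrite Rmult_assoc, Rinv_l, Rmult_1_r by lra. assumption.
    (* Both sides agree because [m = 2 * PI * k + PI / 2] and [m * T0 = 2 * PI]. *)
    - replace (2 * PI / t - INR k * (2 * PI) - PI / 2) with (m * (T0 - t) / t).
      + unfold Rdiv. rewrite Rabs_mult, Rabs_inv, (Rabs_pos_eq t) by lra.
        apply Rmult_le_reg_r with t; [lra|].
        rewrite Rmult_assoc, Rinv_l, Rmult_1_r by lra. apply Rabs_le. split; nra.
      + rewrite Rmult_minus_distr_l, hm. unfold m, mu. field. lra.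
    - intros s. rewrite <- (HT (s * (t / (2 * PI)))). f_equal. field. lra.
    - intros s.
      replace (- ((m - eta) * (t / (2 * PI))) *
               f (x ((s - (2 * PI / t - INR k * (2 * PI))) * (t / (2 * PI)))))
        with (- (m - eta) * f (x (s * (t / (2 * PI)) - 1)) * (t / (2 * PI))).
      + apply (dlim_comp x (fun u => u * (t / (2 * PI)))); [|apply Hx].
        eapply dlim_eq; [apply dlim_mult; [apply derivable_pt_lim_id|apply derivable_pt_lim_const]|].
        unfold id. ring.
      (* Adding [k] whole periods to the delayed argument reduces the delay [2 * PI / t] by
         [2 * PI * k]. *)
      + rewrite <- (is_period_IZR x t HT (Z.of_nat k) (s * (t / (2 * PI)) - 1)), <- INR_IZR_INZ.
        replace (s * (t / (2 * PI)) - 1 + INR k * t)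
          with ((s - (2 * PI / t - INR k * (2 * PI))) * (t / (2 * PI))) by (field; lra).
        ring.
    - intros s. apply Rlt_le, Hd1.
    - destruct Hne as [u [v huv]].
      assert (E : forall w, x (w * (2 * PI / t) * (t / (2 * PI))) = x w).
      { intros w. f_equal. field. lra. }
      destruct (Req_dec (x u) 0) as [hu|hu].
      + exists (v * (2 * PI / t)). rewrite E. congruence.
      + exists (u * (2 * PI / t)). now rewrite E. }
  (* The claimed denominator is [2 / PI] times the parameter, so after clearing it the claim is 4
     times [Hlam]. *)
  assert (ED : 4 * INR k + 1 - 2 * eta / PI = (m - eta) * (2 / PI)).
  { unfold m, mu. field. lra. }
  assert (hD : 0 < (m - eta) * (2 / PI)).
  { apply Rmult_lt_0_compat; [lra|apply Rdiv_lt_0_compat; lra]. }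
  rewrite ED. apply Rmult_le_reg_r with ((m - eta) * (2 / PI)); [exact hD|].
  replace (4 / ((m - eta) * (2 / PI)) * ((m - eta) * (2 / PI))) with 4 by (field; lra).
  replace (t * ((m - eta) * (2 / PI))) with (4 * ((m - eta) * (t / (2 * PI)))) by (field; lra).
  lra.
Qed.
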